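(* Let $f_1,\dots,f_M:\mathbb{R}^n\to\mathbb{R}^n$ be locally Lipschitz with $f_i(0)=0$ for all $i\in\mathcal Q=\{1,\dots,M\}$. Let $V:\mathbb R^n\to\mathbb R_+$ be smooth (continuously differentiable on all of $\mathbb R^n$) and suppose there is a continuous function $W:\mathbb R^n\to\mathbb R_+$ such that: $V(x)>0$ and $W(x)>0$ for all $x\ne0$, and $V(0)=0$; $\{x:V(x)\le\beta\}$ is bounded for each $\beta$; and $\min_{i\in\mathcal Q}\langle\nabla V(x),f_i(x)\rangle\le -W(x)$ for all $x\in\mathbb R^n$. Then the closed-loop system $\dot x(t)=f_{\nu(x(t))}(x(t))$ under the switching law $\nu=\mathcal S[V]$ is globally asymptotically stable including sliding motions.
   Context: Notation: $\mathbb R_+=[0,\infty)$, $\mathcal N(x;\delta)=\{z\in\mathbb R^n:\|z-x\|<\delta\}$, $\mu$ is Lebesgue measure, $\overline{co}$ is closed convex hull. Filippov solutions: for $X:\mathbb R^n\to\mathbb R^n$, $F[X](x)=\bigcap_{\delta>0}\bigcap_{\mu(S)=0}\overline{co}\{X(\mathcal N(x;\delta)\setminus S)\}$. A Filippov solution of $\dot x=X(x)$ is an absolutely continuous $x(\cdot)$ with $\dot x(t)\in F[X](x(t))$ for almost all $t$. Switching law $\nu=\mathcal S[V]$ (for smooth $V$, with the single partition set $\Omega_1=\mathbb R^n$): for $i\in\mathcal Q$ let $$\mathcal D_i=\Big\{x\in\mathbb R^n:\langle\nabla V(x),f_i(x)\rangle<\min_{q\in\mathcal Q,q\ne i}\langle\nabla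 V(x),f_q(x)\rangle\Big\},\qquad \partial\mathcal D=\bigcup_{i\in\mathcal Q}\partial\mathcal D_i.$$ Set $\nu(x)=i$ if $x\in\mathcal D_i$, and $\nu(x)=\min\{i\in\mathcal Q:x\in\partial\mathcal D_i\}$ if $x\in\partial\mathcal D$. The sets $\mathcal D_i$ are open and disjoint; it is taken as standing that $\nu$ is admissible, i.e. $\bigcup_i\bar{\mathcal D}_i=\mathbb R^n$, and that $\partial\mathcal D$ has measure zero. Sliding motions: write $f_{[\nu]}(x)=f_{\nu(x)}(x)$ and let $x(\cdot;z,\nu):\mathbb R_+\to\mathbb R^n$ denote a Filippov solution of $\dot x=f_{[\nu]}(x)$ with initial state $z$. A sliding motion is a part of the trajectory on a nontrivial interval $(t_1,t_2)$ with $\dot x(t;z,\nu)\ne f_{[\nu]}(x(t;z,\nu))$ for almost all $t\in(t_1,t_2)$; it can occur only on $\partial\mathcal D$. For $x\in\partial\mathcal D$ let $\mathcal I_{sm}(x)=\{i\in\mathcal Q:x\in\partial\mathcal D_i\}$. During a sliding motion the velocity at $x$ is $\dot x=\sum_{i\in\mathcal I_{sm}(x)}\alpha_i(x)f_i(x)$ for convex combination coefficients $\alpha_i(x)\ge0$, $\sum_{i\in\mathcal I_{sm}(x)}\alpha_i(x)=1$. With these coefficients, $\mathcal I_{sm}^a(x)=\{i\in\mathcal I_{sm}(x):\alpha_i(x)\ne0\}$. A point $x\in\partial\mathcal D$ is regular if for every $i\in\mathcal I_{sm}^a(x)$ there is $\epsilon_i>0$ with $x-\delta f_i(x)\in\mathcal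 D_i$ for all $\delta\in(0,\epsilon_i)$. Stability including sliding motions: for $\epsilon>0$ let $\mathcal X_{sm}(\epsilon,\nu)$ be the set of Filippov solutions $x(\cdot;z,\nu)$ with $\|z\|\le\epsilon$ such that, whenever $t_1<t_2$ and $\dot x(t;z,\nu)\ne f_{[\nu]}(x(t;z,\nu))$ for a.e. $t\in(t_1,t_2)$, the point $x(t;z,\nu)$ is regular for all $t\in(t_1,t_2)$. The closed-loop system is globally asymptotically stable including sliding motions if (i) for any $\epsilon>0$ there is $\delta>0$ such that every $x(\cdot;z,\nu)\in\mathcal X_{sm}(\delta,\nu)$ satisfies $\|x(t;z,\nu)\|<\epsilon$ for all $t\in\mathbb R_+$, and (ii) $\lim_{t\to\infty}x(t;z,\nu)=0$ for every $x(\cdot;z,\nu)\in\mathcal X_{sm}(\rho,\nu)$ and every $\rho>0$. *)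

(* Defs.v *)
From HB Require Import structures.
From mathcomp Require Import all_boot all_order all_algebra.
From mathcomp Require Import all_classical all_reals all_analysis.

Set Implicit Arguments.
Unset Strict Implicit.
Unset Printing Implicit Defensive.

Import Order.TTheory GRing.Theory Num.Theory.
Import numFieldNormedType.Exports.

Local Open Scope classical_set_scope.
Local Open Scope ring_scope.

Section Euclidean.
Context {R : realType} {n : nat}.
Implicit Types (x v : 'rV[R]_n) (S : set 'rV[R]_n).

Definition dotv x v : R := \sum_(i < n) x 0 i * v 0 i.

(* The library norm on 'rV[R]_n is the sup norm; both norms induce the same
   topology, so closures, limits, boundedness and local Lipschitz continuity
   are taken from the library. *)
Definition enorm x : R := Num.sqrt (dotv x x).

Definition eball x (d : R) : set 'rV[R]_n := [set z | enorm (z - x) < d].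

Definition gradient (V : 'rV[R]_n -> R) x : 'rV[R]_n :=
  \row_(i < n) 'D_(delta_mx 0 i) V x.

Definition boundary S : set 'rV[R]_n := closure S `\` interior S.

Definition box (a b : 'rV[R]_n) : set 'rV[R]_n :=
  [set x | forall i, a 0 i <= x 0 i <= b 0 i].

(* n-dimensional Lebesgue outer measure, for n > 0; the Lebesgue-null sets are
   exactly the sets of outer measure zero. *)
Definition lebesgue_outer S : \bar R :=
  ereal_inf [set s | exists a b : nat -> 'rV[R]_n,
    [/\ forall k i, a k 0 i <= b k 0 i,
        S `<=` \bigcup_k box (a k) (b k) &
        s = (\sum_(0 <= k <oo) (\prod_(i < n) (b k 0 i - a k 0 i))%:E)%E]].

Definition lebesgue_null S : Prop := lebesgue_outer S = 0%E.

Definition closed_convex_hull S : set 'rV[R]_n :=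
  smallest (fun C : set 'rV[R]_n => closed C /\ convex_set C) S.

Definition filippov (X : 'rV[R]_n -> 'rV[R]_n) x : set 'rV[R]_n :=
  \bigcap_(d in [set d : R | 0 < d]) \bigcap_(S in lebesgue_null)
    closed_convex_hull (X @` (eball x d `\` S)).

Definition abs_continuous (a b : R) (x : R -> 'rV[R]_n) : Prop :=
  forall e : R, 0 < e -> exists2 d : R, 0 < d &
    forall (k : nat) (u v : 'I_k -> R),
      (forall j, [/\ a <= u j, u j <= v j & v j <= b]) ->
      trivIset setT (fun j => `]u j, v j[%classic) ->
      \sum_(j < k) (v j - u j) < d ->
      \sum_(j < k) enorm (x (v j) - x (u j)) < e.

(* Solutions live on [0, +oo[: the values of x at negative times are
   irrelevant, and absolute continuity is on compact subintervals. *)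
Definition filippov_solution (X : 'rV[R]_n -> 'rV[R]_n) (x : R -> 'rV[R]_n) :
    Prop :=
  (forall T : R, 0 < T -> abs_continuous 0 T x) /\
  {ae lebesgue_measure, forall t : R, 0 <= t ->
     derivable x t 1 /\ filippov X (x t) (derive1 x t)}.

End Euclidean.

Section Switching.
Context {R : realType} {n M : nat}.
(* The M.+1 modes are numbered from 0. *)
Variables (f : 'I_M.+1 -> 'rV[R]_n -> 'rV[R]_n) (V : 'rV[R]_n -> R).
Implicit Types (i : 'I_M.+1) (x : 'rV[R]_n).

(* The minimum is taken in \bar R, so that it is +oo if there is no other mode. *)
Definition min_region i : set 'rV[R]_n :=
  [set x | ((dotv (gradient V x) (f i x))%:E <
    \big[Order.min/+oo]_(q < M.+1 | q != i)
      (dotv (gradient V x) (f q x))%:E)%E].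

Definition switching_surface : set 'rV[R]_n :=
  \bigcup_i boundary (min_region i).

Definition admissible_law : Prop :=
  \bigcup_i closure (min_region i) = setT.

(* The value is the junk mode 0 at points that lie neither in a region nor on
   the switching surface; there are none when the law is admissible. *)
Definition switching_law x : 'I_M.+1 :=
  if [pick i | x \in min_region i] is Some i then i
  else [arg min_(i < ord0 | x \in boundary (min_region i)) (i : nat)]%N.

Definition closed_loop x : 'rV[R]_n := f (switching_law x) x.

Definition sliding_modes x : set 'I_M.+1 :=
  [set i | boundary (min_region i) x].

Definition convex_coefs (a : 'I_M.+1 -> R) x : Prop :=
  (forall i, i \in sliding_modes x -> 0 <= a i) /\
  \sum_(i < M.+1 | i \in sliding_modes x) a i = 1.

Definition active_modes (a : 'I_M.+1 -> R) x : set 'I_M.+1 :=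
  sliding_modes x `&` [set i | a i != 0].

Definition regular_point (a : 'I_M.+1 -> R) x : Prop :=
  switching_surface x /\
  forall i, active_modes a x i ->
    exists2 e : R, 0 < e &
      forall d : R, 0 < d < e -> min_region i (x - d *: f i x).

Definition sliding_motion (x : R -> 'rV[R]_n) (t1 t2 : R) : Prop :=
  [/\ 0 <= t1, t1 < t2 &
    {ae lebesgue_measure, forall t : R, t1 < t < t2 ->
       derive1 x t != closed_loop (x t)}].

(* The coefficients that represent the sliding velocity need not be unique:
   a trajectory qualifies as soon as it is regular for one choice of them.
   They are indexed by the time at which the trajectory visits the point, so
   that no trajectory is left out because it passes twice through a point
   with different velocities. *)
Definition regular_sliding (x : R -> 'rV[R]_n) (t1 t2 : R) : Prop :=
  exists a : R -> 'I_M.+1 -> R,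
    [/\ forall t, t1 < t < t2 -> convex_coefs (a t) (x t),
        {ae lebesgue_measure, forall t : R, t1 < t < t2 ->
           derive1 x t =
           \sum_(i < M.+1 | i \in sliding_modes (x t)) a t i *: f i (x t)} &
        forall t, t1 < t < t2 -> regular_point (a t) (x t)].

Definition sliding_solutions (e : R) : set (R -> 'rV[R]_n) :=
  [set x | [/\ filippov_solution closed_loop x, enorm (x 0) <= e &
    forall t1 t2 : R, sliding_motion x t1 t2 -> regular_sliding x t1 t2]].

Definition gas_including_sliding : Prop :=
  (forall e : R, 0 < e -> exists2 d : R, 0 < d &
     forall x : R -> 'rV[R]_n, sliding_solutions d x -> forall t : R, 0 <= t ->
       enorm (x t) < e) /\
  (forall r : R, 0 < r -> forall x : R -> 'rV[R]_n, sliding_solutions r x ->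
     x t @[t --> +oo] --> (0 : 'rV[R]_n)).

End Switching.

(* Main.v *)
Require Import Defs.
From HB Require Import structures.
From mathcomp Require Import all_boot all_order all_algebra.
From mathcomp Require Import all_classical all_reals all_analysis.
From mathcomp Require Import ring lra.
Import Order.TTheory GRing.Theory Num.Theory.
Import numFieldNormedType.Exports.
Local Open Scope classical_set_scope.
Local Open Scope ring_scope.

(* Off the switching surface, which is Lebesgue-null and hence may be removed in
   Filippov's construction, the closed-loop field at y is f_i(y) with i the
   minimizing mode, so <grad V(y), f_i(y)> <= -W(y).  By continuity every
   Filippov velocity v at x lies in the closed half-space
   <grad V(x), v> <= -W(x): since V is C^1 everywhere, no case distinction is
   needed for sliding motions.  An absolutely continuous function whose
   derivative is at most c almost everywhere grows at rate at most c, so V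
   decreases along solutions, at a uniform rate as long as V stays away from 0;
   compactness of the sublevel sets of V turns this into stability and
   convergence. *)

(** * Growth of absolutely continuous real functions *)

Section RealAbsoluteContinuity.
Context {R : realType}.
Implicit Types (phi : R -> R) (a b c d : R).

Definition abs_continuous_real a b phi : Prop :=
  forall e : R, 0 < e -> exists2 d : R, 0 < d &
    forall (k : nat) (u v : 'I_k -> R),
      (forall j, [/\ a <= u j, u j <= v j & v j <= b]) ->
      trivIset setT (fun j => `]u j, v j[%classic) ->
      \sum_(j < k) (v j - u j) < d ->
      \sum_(j < k) `|phi (v j) - phi (u j)| < e.

Lemma abs_continuous_real_sub phi a b c d :
  a <= c -> d <= b -> abs_continuous_real a b phi -> abs_continuous_real c d phi.
Proof.
move=> ac db acp e /acp[r r0 rP]; exists r => // k u v uv; apply: rP => j.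
by have [cu ? vd] := uv j; split=> //; [exact: le_trans cu | exact: le_trans db].
Qed.

(** Finite additivity and monotonicity of the measure; degenerate intervals are empty and contribute
    0 on both sides. It turns an open cover of small measure into the length condition of absolute
    continuity. *)
Lemma sum_length_le_measure k (u v : 'I_k -> R) (U : set R) :
  (forall j, u j <= v j) ->
  trivIset setT (fun j => `]u j, v j[%classic) ->
  measurable U -> (forall j, `]u j, v j[ `<=` U) ->
  ((\sum_(j < k) (v j - u j))%:E <= lebesgue_measure U)%E.
Proof.
move=> uv tuv mU uvU.
have muv j : lebesgue_measure `]u j, v j[%classic = (v j - u j)%:E.
  rewrite lebesgue_measure_itv /= lte_fin -EFinB; case: ltP => // vu.
  by have -> : v j = u j by [apply/le_anti; rewrite uv vu]; rewrite subrr.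
rewrite (_ : (_%:E)%E = lebesgue_measure (\bigcup_(j in setT) `]u j, v j[%classic)).
  apply: le_measure; rewrite ?inE//; last by move=> t [j _]; exact: uvU.
  by apply: fin_bigcup_measurable => // j _; exact: measurable_itv.
rewrite measure_fin_bigcup//; last exact: finite_finset.
rewrite -sumEFin (fsbigE (enum 'I_k)) ?enum_uniq//=; last first.
  by move=> i _; rewrite mem_enum.
by rewrite [RHS]big_mkcond big_enum/=; apply: eq_bigr => j _; rewrite in_setT muv.
Qed.

(** Take the supremum of the points of [[a, b]] where [P] holds. The step at the supremum starts
    from a nearby point on its left and ends on its right, so it shows at once that the supremum is
    attained and that it cannot lie below [b]. *)
Lemma real_induction (P : R -> Prop) a b : a <= b -> P a ->
  (forall t, a <= t <= b -> exists2 g, 0 < g & forall u v,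
     a <= u <= t -> t <= v <= b -> t - g < u -> v < t + g -> P u -> P v) ->
  P b.
Proof.
move=> ab Pa step; pose E := [set s | a <= s <= b /\ P s].
have Ea : E a by split=> //; rewrite lexx.
have ubE : ubound E b by move=> s [/andP[]].
have hsE : has_sup E by split; [exists a | exists b].
have as_ : a <= sup E by apply: sup_upper_bound.
have sb : sup E <= b by apply: ge_sup => //; exists a.
have [|g g0 gP] := step (sup E); first by rewrite as_.
have [u Eu uE] := sup_adherent g0 hsE.
have us : u <= sup E by apply: sup_upper_bound.
case: (Eu) => /andP[au ub] Pu.
pose w := Num.min b (sup E + g / 2).
have sw : sup E <= w by rewrite le_min sb/= lerDl ltW// divr_gt0.
have wb : w <= b by rewrite ge_min lexx.
have Pw : P w.
  apply: (gP u w) => //; rewrite ?au ?sw//.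
  by rewrite gt_min orbC ltrD2l ltr_pdivrMr// mulr2n mulrDr !mulr1 ltrDl g0.
have ws : w <= sup E.
  by apply: sup_upper_bound => //; split=> //; rewrite wb (le_trans as_).
suff <- : w = b by [].
apply/eqP; rewrite eq_le wb leNgt; apply/negP => wb'.
have wq : w < sup E + g / 2 by rewrite (le_lt_trans ws)// ltrDl divr_gt0.
by have : w < w; [rewrite {2}/w lt_min wb' wq | rewrite ltxx].
Qed.

(** The Carathéodory slope [h] of [phi] at [t] is continuous at [t], hence below [c + e] nearby; the
    increment splits at [t] into [h v * (v - t)] and [h u * (t - u)]. *)
Lemma derive_locally_le phi t c e : derivable phi t 1 -> derive1 phi t <= c ->
  0 < e -> exists2 g, 0 < g & forall u v, u <= t -> t <= v ->
     t - g < u -> v < t + g -> phi v - phi u <= (c + e) * (v - u).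
Proof.
move=> dphi phic e0.
have /is_derive1_caratheodory[h [hE hc ht]] : is_derive t 1 phi (derive1 phi t).
  by rewrite derive1E; exact: derivableP.
have : \forall z \near t, h z < c + e.
  move/cvgr_lt: hc; apply.
  by rewrite ht; apply: le_lt_trans phic _; rewrite ltrDl.
move=> /nbhs_ballP[g /= g0 gP]; exists g => // u v ut tv gu vg.
have hu : h u < c + e.
  by apply: gP; rewrite /ball/= ger0_norm; lra.
have hv : h v < c + e.
  by apply: gP; rewrite /ball/= ler0_norm; lra.
have := hE u; have := hE v; nra.
Qed.

(** Appends the interval from [s] to [w] at the index [ord_max], where [unlift] returns [None]; all
    earlier intervals end by [s]. *)
Lemma trivIset_rcons_itv k (u v : 'I_k -> R) (s w : R) :
  trivIset setT (fun j => `]u j, v j[%classic) -> (forall j, v j <= s) ->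
  let u' := fun j : 'I_k.+1 => oapp u s (unlift ord_max j) in
  let v' := fun j : 'I_k.+1 => oapp v w (unlift ord_max j) in
  trivIset setT (fun j => `]u' j, v' j[%classic).
Proof.
move=> tuv vs u' v'; apply/trivIsetP => i j _ _.
wlog : i j / (i < j)%N.
  move=> H ij; have [lij|lji|/val_inj eij] := ltngtP i j.
  - exact: H.
  - by rewrite setIC; apply: H => //; rewrite eq_sym.
  - by rewrite eij eqxx in ij.
move=> lij _; rewrite /u' /v'.
case: unliftP => [i' iE|iE]; last first.
  by move: lij; rewrite iE /= ltnNge -ltnS ltn_ord.
case: unliftP => [j' jE|jE] /=.
  move/trivIsetP: tuv; apply => //; apply: contraTneq lij => ij.
  by rewrite iE jE ij ltnn.
rewrite -subset0 => t [] /=; rewrite !in_itv/= => /andP[_ tv] /andP[st _].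
by have := vs i'; rewrite leNgt (lt_trans st).
Qed.

(* The increments over intervals inside a small open cover of the exceptional
   null set are controlled by absolute continuity, all the others by the
   derivative.  The terms [`|c| * (v j - u j)] compensate for [c + e] being
   possibly negative on the former intervals. *)
Lemma abs_continuous_growth a b c phi : a <= b ->
  abs_continuous_real a b phi ->
  {ae lebesgue_measure, forall t : R, a <= t <= b ->
     derivable phi t 1 /\ derive1 phi t <= c} ->
  phi b - phi a <= c * (b - a).
Proof.
move=> ab ac [N [mN N0 badN]].
(* One [e] pays for the increments over the exceptional intervals, the other for the compensating
   terms in [|c|]; the total error [e * (b - a + 2)] is then rescaled. *)
suff H e : 0 < e -> phi b - phi a <= (c + e) * (b - a) + e + e.
  apply/ler_addgt0Pr => e e0.
  have D0 : 0 < b - a + 2 by lra.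
  have /H : 0 < e / (b - a + 2) by rewrite divr_gt0.
  set q := e / _; have -> : e = q * (b - a + 2) by rewrite /q divfK ?gt_eqF.
  by lra.
move=> e0; have [d1 d10 acd] := ac e e0.
(* The second bound gives [|c| * d <= e]; the added 1 covers [c = 0]. *)
pose d := Num.min d1 (e / (`|c| + 1)).
have c1 : 0 < `|c| + 1 by rewrite ltr_wpDl.
have d0 : 0 < d by rewrite lt_min d10 divr_gt0.
have dd1 : d <= d1 by rewrite ge_min lexx.
have cd : `|c| * d <= e.
  apply: (@le_trans _ _ ((`|c| + 1) * d)).
    by rewrite ler_wpM2r ?lerDl// ltW.
  by rewrite mulrC -ler_pdivlMr// ge_min lexx orbT.
have [U [oU NU mUN]] : exists U : set R,
    [/\ open U, N `<=` U & (lebesgue_measure (U `\` N)%classic < d%:E)%E].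
  by apply: lebesgue_regularity_outer => //; rewrite [ltLHS]N0 ltry.
have mU : measurable U by exact: measurable_realfun.open_measurable.
have Ud : (lebesgue_measure U < d%:E)%E.
  rewrite -(setDKU NU) setUC; apply: le_lt_trans mUN.
  apply: le_trans (measureU2 _ _ _) _ => //; first exact: measurableD.
  by rewrite [X in (X + _)%E]N0 add0e.
(* The invariant carried from [a] to [b]: the excess over slope [c + e] comes only from disjoint
   intervals inside [U], collected so far. *)
pose P s := exists k (u v : 'I_k -> R),
  [/\ forall j, [/\ a <= u j, u j <= v j & v j <= s],
      forall j, `]u j, v j[ `<=` U,
      trivIset setT (fun j => `]u j, v j[%classic) &
      phi s - phi a <= (c + e) * (s - a) +
      \sum_(j < k) (`|phi (v j) - phi (u j)| + `|c| * (v j - u j))].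
suff [k [u [v [uv uvU tuv]]]] : P b.
  have len : \sum_(j < k) (v j - u j) < d.
    rewrite -lte_fin; apply: le_lt_trans Ud; apply: sum_length_le_measure => //.
    by move=> j; case: (uv j).
  move=> /le_trans; apply; rewrite -addrA lerD2l big_split/= -mulr_sumr.
  apply: lerD; first exact/ltW/acd/(lt_le_trans len).
  by apply: le_trans cd; rewrite ler_wpM2l// ltW.
apply: (@real_induction P a b) => //.
  exists 0%N, (fun _ => 0), (fun _ => 0); split; try by case.
  by rewrite big_ord0 !subrr mulr0 addr0.
move=> t atb.
have good_step s w : a <= s -> s <= w -> P s ->
    phi w - phi s <= (c + e) * (w - s) -> P w.
  move=> as_ sw [k [u [v [uv uvU tuv phis]]]] phiw.
  exists k, u, v; split=> // [j|].
    by have [? ? vs] := uv j; split=> //; exact: le_trans sw.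
  by lra.
have bad_step s w : a <= s -> s <= w -> P s -> `]s, w[ `<=` U -> P w.
  move=> as_ sw [k [u [v [uv uvU tuv phis]]]] swU.
  exists k.+1, (fun j => oapp u s (unlift ord_max j)),
    (fun j => oapp v w (unlift ord_max j)); split.
  - move=> j; case: unliftP => [i _|_]//=.
    by have [? ? vs] := uv i; split=> //; exact: le_trans sw.
  - by move=> j; case: unliftP => [i _|_]//=.
  - by apply: trivIset_rcons_itv => // j; case: (uv j).
  - rewrite big_ord_recr /= unlift_none /=.
    under eq_bigr => i _.
      have -> : widen_ord (leqnSn k) i = lift ord_max i.
        by apply: val_inj; rewrite /= /bump leqNgt ltn_ord.
      rewrite liftK/=; over.
    have := ler_norm (phi w - phi s).
    have : - `|c| * (w - s) <= (c + e) * (w - s).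
      rewrite ler_wpM2r ?subr_ge0//; have := ler_norm (- c).
      by rewrite normrN; lra.
    by lra.
case: (pselect (N t)) => [Nt|nNt].
  have /nbhs_ballP[g /= g0 gU] : nbhs t U by apply: open_nbhs_nbhs; split=> //; exact: NU.
  exists g => // s w /andP[as_ st] /andP[tw _] gs gw Ps.
  apply: bad_step Ps _ => //; first exact: le_trans tw.
  move=> r; rewrite /= in_itv/= => /andP[sr rw]; apply: gU.
  by rewrite /ball/= ltr_norml; lra.
have [dphi phic] : derivable phi t 1 /\ derive1 phi t <= c.
  by apply: contrapT => H; apply: nNt; apply: badN => /(_ atb).
have [g g0 gP] := derive_locally_le _ _ _ _ dphi phic e0.
exists g => // s w /andP[as_ st] /andP[tw _] gs gw Ps.
apply: good_step Ps _ => //; first exact: le_trans tw.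
exact: gP.
Qed.

End RealAbsoluteContinuity.

(** * Euclidean norm, gradients and the regularity of V along trajectories *)

Section EuclideanNorm.
Context {R : realType} {n : nat}.

Lemma coord_le_norm (x : 'rV[R]_n) i : `|x 0 i| <= `|x|.
Proof.
by rewrite {2}/Num.norm/= mx_normrE; apply/bigmax_geP; right; exists (0, i).
Qed.

Lemma norm_le_coord (x : 'rV[R]_n) (c : R) : 0 <= c -> (forall i, `|x 0 i| <= c) -> `|x| <= c.
Proof.
move=> c0 xc; rewrite {1}/Num.norm/= mx_normrE; apply/bigmax_leP; split=> //.
by move=> [i j] _ /=; rewrite (ord1 i).
Qed.

Lemma norm_le_enorm (x : 'rV[R]_n) : `|x| <= enorm x.
Proof.
apply: norm_le_coord => [|i]; first exact: sqrtr_ge0.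
rewrite -sqrtr_sqr ler_wsqrtr// /dotv (bigD1 i)//= expr2 lerDl.
by apply: sumr_ge0 => j _; rewrite -expr2 sqr_ge0.
Qed.

Lemma enorm_eq0 (x : 'rV[R]_n) : (enorm x == 0) = (x == 0).
Proof.
apply/idP/idP => [/eqP x0|/eqP ->]; last first.
  by rewrite /enorm /dotv big1 ?sqrtr0// => i _; rewrite mxE mul0r.
by rewrite -normr_le0 -x0 norm_le_enorm.
Qed.

Lemma continuous_dotv (T : topologicalType) (g h : T -> 'rV[R]_n) :
  continuous g -> continuous h -> continuous (fun t => dotv (g t) (h t)).
Proof.
move=> cg ch; apply: (continuous_big add_continuous) => i _ t.
have coord (k : T -> 'rV[R]_n) : continuous k -> {for t, continuous (fun y => k y 0 i)}.
  move=> ck; apply: (@continuous_comp _ _ _ k (fun M : 'rV[R]_n => M 0 i)).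
    exact: ck.
  exact: coord_continuous.
by apply: (@continuousM R T (fun y => g y 0 i) (fun y => h y 0 i)); exact: coord.
Qed.

Lemma continuous_enorm : continuous (@enorm R n).
Proof.
move=> x; apply: (@continuous_comp _ _ _ (fun y => dotv y y) Num.sqrt).
  by apply: (continuous_dotv _ (fun y => y) (fun y => y)) => z; exact: cvg_id.
exact: sqrt_continuous.
Qed.

(** A crude form of Cauchy-Schwarz, from bounding each coordinate of [v] by [enorm v]; the constant
    is still continuous in [x], as needed for a Lipschitz bound on compact sets. *)
Lemma norm_dotv_le (x v : 'rV[R]_n) : `|dotv x v| <= (\sum_(i < n) `|x 0 i|) * enorm v.
Proof.
rewrite /dotv mulr_suml (le_trans (ler_norm_sum _ _ _))// ler_sum// => i _.
by rewrite normrM ler_wpM2l// (le_trans (coord_le_norm _ _))// norm_le_enorm.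
Qed.

Lemma locally_lipschitz_continuous (g : 'rV[R]_n -> 'rV[R]_n) :
  [locally [lipschitz g x | x in [set: 'rV[R]_n]]] -> continuous g.
Proof.
(* Near the diagonal point [(x, x)] the Lipschitz bound holds on a product [A] × [B]; it is used at
   the pairs [(y, x)]. *)
move=> lg x; have /pinfty_ex_gt0[L L0] := lg (x, x) (conj I I).
case=> -[A B] /= [nA nB] AB.
apply/(@cvgrPdist_lt _ _ _ (nbhs x) (nbhs_filter x) g) => e e0.
have nball : nbhs x (ball x (e / L)) by apply: nbhsx_ballx; rewrite divr_gt0.
apply: filterS2 nA nball => y Ay; rewrite -ball_normE /=.
rewrite ltr_pdivlMr// mulrC; apply: le_lt_trans.
rewrite distrC [`|x - y|]distrC.
by apply: (AB (y, x)) => //; split=> //=; exact: nbhs_singleton nB.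
Qed.

Lemma diff_gradient (V : 'rV[R]_n -> R) (x v : 'rV[R]_n) :
  differentiable V x -> 'd V x v = dotv (gradient V x) v.
Proof.
move=> dV; rewrite {1}(row_sum_delta v) linear_sum/= /dotv.
apply: eq_bigr => i _; rewrite linearZ /= mxE deriveE// mulrC.
by [].
Qed.

Lemma is_derive_along (V : 'rV[R]_n -> R) (x : R -> 'rV[R]_n) (t : R) :
  differentiable V (x t) -> derivable x t 1 ->
  is_derive t 1 (V \o x) (dotv (gradient V (x t)) (derive1 x t)).
Proof.
move=> dV /[dup] xt /derivable1_diffP dx.
have dVx : differentiable (V \o x) t by exact: differentiable_comp.
have -> : dotv (gradient V (x t)) (derive1 x t) = 'D_1 (V \o x) t.
  by rewrite deriveE// diff_comp//= diff_gradient// derive1E'.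
by apply: derivableP; exact/derivable1_diffP.
Qed.

(** Mean value theorem along the segment from [x] to [y], which stays in the convex ball of radius
    [r]; [L] is the maximum over this compact ball of the sum [G] of the absolute partial
    derivatives. *)
Lemma C1_lipschitz (V : 'rV[R]_n -> R) (r : R) :
  (forall x, differentiable V x) -> continuous (gradient V) ->
  exists2 L : R, 0 <= L & forall x y : 'rV[R]_n, `|x| <= r -> `|y| <= r ->
    `|V y - V x| <= L * enorm (y - x).
Proof.
move=> dV cV.
pose G (x : 'rV[R]_n) := \sum_(i < n) `|gradient V x 0 i|.
have G0 x : 0 <= G x by apply: sumr_ge0.
have cG : continuous G.
  apply: (continuous_big add_continuous) => i _ t.
  apply: (@continuous_comp _ _ _ (fun x => gradient V x 0 i) Num.norm); last first.
    exact: norm_continuous.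
  apply: (@continuous_comp _ _ _ (gradient V) (fun M : 'rV[R]_n => M 0 i)).
    exact: cV.
  exact: coord_continuous.
pose K := [set x : 'rV[R]_n | `|x| <= r].
have cK : compact K.
  apply: bounded_closed_compact; first by
    exists r; split=> [|m rm x /le_trans]; [exact: num_real | apply; exact: ltW].
  apply: (@preimage_closed _ _ (Num.norm : 'rV[R]_n -> R) [set s | s <= r]).
    by move=> x _; exact: norm_continuous.
  exact: closed_le.
(* For negative [r] the ball is empty and has no maximizer, but the bound is vacuous. *)
have [r0|r0] := ltP r 0.
  by exists 0 => // x y /(le_trans (normr_ge0 _)); rewrite leNgt r0.
have [||c _ cmax] := @EVT_max_rV R n G K _ cK.
- by exists 0; rewrite /K/= normr0.
- exact: continuous_subspaceT.
exists (G c) => // x y xr yr.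
pose p (s : R) : 'rV[R]_n := x + s *: (y - x).
have dp s : derivable p s 1 /\ derive1 p s = y - x.
  have dl : is_diff s (fun s : R => s *: (y - x)) ( *:%R ^~ (y - x)).
    exact: is_diff_scalel.
  have lp : derivable (fun s : R => s *: (y - x)) s 1.
    by apply/derivable1_diffP; exact: ex_diff.
  have dlE : 'D_1 (fun s : R => s *: (y - x)) s = y - x.
    by rewrite deriveE ?diff_val ?scale1r//; exact: ex_diff.
  have dc := @derivable_cst R R 'rV[R]_n x s 1.
  split; first exact: (derivableD dc lp).
  by rewrite derive1E (deriveD dc lp) derive_cst add0r dlE.
have dVp (s : R) : is_derive s 1 (V \o p) (dotv (gradient V (p s)) (y - x)).
  by have [dps <-] := dp s; exact: is_derive_along.
have [|s s01] := @MVT_segment R (V \o p) _ 0 1 ler01 (fun s _ => dVp s).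
  apply: continuous_subspaceT => s.
  by apply: differentiable_continuous; apply/derivable1_diffP; have [] := dVp s.
rewrite /p/= scale0r addr0 scale1r subrKC subr0 mulr1 => ->.
apply: le_trans (norm_dotv_le _ _) _; rewrite ler_wpM2r ?sqrtr_ge0//.
apply: cmax; rewrite inE /K/=.
have /andP[s0 s1] : 0 <= s <= 1 by move: s01; rewrite in_itv.
have -> : x + s *: (y - x) = (1 - s) *: x + s *: y.
  by rewrite scalerBr scalerBl scale1r -addrA [- _ + _]addrC.
apply: le_trans (ler_normD _ _) _; rewrite !normrZ !ger0_norm ?subr_ge0//.
nra.
Qed.

(** Over a time shorter than [d] the norm grows by at most 1, and finitely many steps of length
    [d / 2] cover [[0, T]]. *)
Lemma abs_continuous_bounded (x : R -> 'rV[R]_n) (T : R) : 0 <= T ->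
  abs_continuous 0 T x -> exists r, forall t, 0 <= t <= T -> `|x t| <= r.
Proof.
move=> T0 /(_ 1 ltr01)[d d0 acd].
have step u v : 0 <= u -> u <= v -> v <= T -> v - u < d -> `|x v| <= `|x u| + 1.
  move=> u0 uv vT vud.
  have := acd 1%N (fun=> u) (fun=> v).
  rewrite !big_ord1 => /(_ _ _ vud) H.
  rewrite -lerBlDl (le_trans (lerB_dist _ _))// (le_trans (norm_le_enorm _))// ltW//.
  apply: H => [j|]; first by split.
  by apply/trivIsetP => i j _ _; rewrite (ord1 i) (ord1 j) eqxx.
pose N := Num.Def.archi_bound (T / (d / 2)).
suff H k t : 0 <= t -> t <= T -> t <= k%:R * (d / 2) -> `|x t| <= `|x 0| + k%:R.
  exists (`|x 0| + N%:R) => t /andP[t0 tT]; apply: H => //.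
  apply: (le_trans tT); rewrite -ler_pdivrMr ?divr_gt0//.
  by rewrite ltW// archi_boundP// divr_ge0// ltW// divr_gt0.
elim: k t => [|k IH] t t0 tT.
  by rewrite mul0r addr0 => t0'; have -> : t = 0 by [apply/le_anti; rewrite t0 t0'].
(* One step back from [t], cut off at time 0; half of [d] keeps [t - s] strictly below [d]. *)
move=> tk; pose s := Num.max 0 (t - d / 2).
have s0 : 0 <= s by rewrite le_max lexx.
have st : s <= t by rewrite ge_max t0 gerBl ltW// divr_gt0.
have ts : t - d / 2 <= s by rewrite le_max lexx orbT.
have tsd : t - s < d.
  rewrite ltrBlDr -ltrBlDl (lt_le_trans _ ts)// ltrD2l ltrN2.
  by rewrite ltr_pdivrMr// mulr_natr ltrDl.
apply: le_trans (step s t s0 st tT tsd) _.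
rewrite -natr1 addrA lerD2r; apply: IH => //; first exact: le_trans tT.
rewrite /s ge_max mulr_ge0//= ?divr_ge0// ?(ltW d0)//.
by rewrite lerBlDr -[X in _ + X]mul1r -mulrDl natr1.
Qed.

(** On [[0, T]] the trajectory stays in a ball, where [V] is Lipschitz. *)
Lemma abs_continuous_comp_C1 (V : 'rV[R]_n -> R) (x : R -> 'rV[R]_n) (T : R) :
  0 <= T -> (forall x, differentiable V x) -> continuous (gradient V) ->
  abs_continuous 0 T x -> abs_continuous_real 0 T (V \o x).
Proof.
move=> T0 dV cV acx.
have [r xr] := abs_continuous_bounded _ _ T0 acx.
have [L L0 VL] := C1_lipschitz V r dV cV.
move=> e e0; have L1 : 0 < L + 1 by rewrite ltr_wpDl.
have [d d0 acd] := acx (e / (L + 1)) (divr_gt0 e0 L1).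
exists d => // k u v uv tuv sd; have := acd k u v uv tuv sd.
rewrite ltr_pdivlMr// mulrC mulr_sumr; apply: le_lt_trans.
apply: ler_sum => j _; have [uj ujvj vj] := uv j.
apply: (@le_trans _ _ (L * enorm (x (v j) - x (u j)))).
  apply: VL; apply: xr; first by rewrite uj (le_trans ujvj).
  by rewrite vj (le_trans uj).
by rewrite ler_wpM2r ?sqrtr_ge0// lerDl.
Qed.

End EuclideanNorm.

(** * Sublevel sets of V and its decay along Filippov solutions *)

Section Lyapunov.
Context {R : realType} {n : nat}.

Lemma continuous_C1 (V : 'rV[R]_n -> R) :
  (forall x, differentiable V x) -> continuous V.
Proof. by move=> dV x; exact: differentiable_continuous. Qed.

Lemma sublevel_compact (V : 'rV[R]_n -> R) (beta : R) :
  continuous V -> (forall b : R, bounded_set [set x | V x <= b]) ->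
  compact [set x | V x <= beta].
Proof.
move=> cV bV; apply: bounded_closed_compact; first exact: bV.
by apply: (@preimage_closed _ _ V [set s | s <= beta]) => [x _|]; [exact: cV|exact: closed_le].
Qed.

(** Applied with [g] the Euclidean norm and with [g] equal to [V], it provides compact shells away
    from 0 on which [V] or [W] has a positive minimum. *)
Lemma sublevel_superlevel_compact (V g : 'rV[R]_n -> R) (beta m : R) :
  continuous V -> continuous g -> (forall b : R, bounded_set [set x | V x <= b]) ->
  compact [set x | V x <= beta /\ m <= g x].
Proof.
move=> cV cg bV; apply: subclosed_compact (sublevel_compact V beta cV bV) _.
  apply: closedI.
    apply: (@preimage_closed _ _ V [set s | s <= beta]) => [x _|]; [exact: cV|exact: closed_le].
  by apply: (@preimage_closed _ _ g [set s | m <= s]) => [x _|]; [exact: cg|exact: closed_ge].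
by move=> x [].
Qed.

Lemma sublevel_enorm_lt (V : 'rV[R]_n -> R) (e : R) :
  continuous V -> (forall b : R, bounded_set [set x | V x <= b]) ->
  (forall x, x != 0 -> 0 < V x) -> 0 < e ->
  exists2 m : R, 0 < m & forall x, V x < m -> enorm x < e.
Proof.
move=> cV bV V0 e0; pose K := [set x | V x <= 1 /\ e <= enorm x].
have cK : compact K.
  by apply: sublevel_superlevel_compact => //; exact: continuous_enorm.
have [K0|/set0P K0] := eqVneq K set0.
  exists 1 => // x Vx; rewrite ltNge; apply/negP => ex.
  have Kx : K x by split=> //; exact: ltW.
  by rewrite K0 in Kx.
have [c] := EVT_min_rV K0 cK (continuous_subspaceT cV).
rewrite inE => -[Vc1 ec] cmin.
have Vc : 0 < V c by apply: V0; rewrite -enorm_eq0 gt_eqF// (lt_le_trans e0).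
(* The cap 1 puts a point with [V x < m] and norm at least [e] into [K], against the minimality of
   [V c]. *)
exists (Num.min 1 (V c)); first by rewrite lt_min ltr01.
move=> x; rewrite lt_min => /andP[Vx1 Vxc]; rewrite ltNge; apply/negP => ex.
have /cmin : x \in K by rewrite inE; split=> //; exact: ltW.
by rewrite leNgt Vxc.
Qed.

Lemma closed_half_space (g : 'rV[R]_n) (c : R) : closed [set v | dotv g v <= c].
Proof.
apply: (@preimage_closed _ _ (dotv g) [set s | s <= c]) => [x _|]; last exact: closed_le.
by apply: (continuous_dotv _ (fun=> g) (fun y => y)) => z; [exact: cst_continuous|exact: cvg_id].
Qed.

Lemma convex_half_space (g : 'rV[R]_n) (c : R) :
  convex_set [set v | dotv g v <= c].
Proof.
move=> x y l; rewrite !inE /= => xc yc.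
have -> : conv l x y = l%:num *: (x : 'rV[R]_n) + (1 - l%:num) *: (y : 'rV[R]_n) by [].
have -> : dotv g (l%:num *: (x : 'rV[R]_n) + (1 - l%:num) *: (y : 'rV[R]_n)) =
    l%:num * dotv g x + (1 - l%:num) * dotv g y.
  rewrite /dotv !mulr_sumr -big_split/=; apply: eq_bigr => i _.
  by rewrite !mxE; ring.
have l0 : 0 <= l%:num by [].
have l1 : l%:num <= 1 by [].
nra.
Qed.

(** On its region mode [i] attains the minimum over all modes: if its rate exceeded [w], so would
    all the others, and the minimum too. *)
Lemma min_region_decr (M : nat) (f : 'I_M.+1 -> 'rV[R]_n -> 'rV[R]_n)
    (V : 'rV[R]_n -> R) (w : R) (x : 'rV[R]_n) (i : 'I_M.+1) :
  (\big[Order.min/+oo]_(i < M.+1) (dotv (gradient V x) (f i x))%:E <= w%:E)%E ->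
  min_region f V i x -> dotv (gradient V x) (f i x) <= w.
Proof.
move=> + Di; apply: contraTT; rewrite -!ltNge => wi.
elim/big_ind : _ => [|u v wu wv|q _]; first exact: ltry.
  by rewrite lt_min wu.
have [->|qi] := eqVneq q i; first by rewrite lte_fin.
apply: lt_trans (_ : _ < (dotv (gradient V x) (f i x))%:E)%E _; first by rewrite lte_fin.
apply: lt_le_trans Di _.
exact: bigmin_le_cond.
Qed.

(** By admissibility [x] is in the closure of some region; not being on its boundary, it is in the
    interior, so the [pick] in [switching_law] succeeds. *)
Lemma switching_law_min_region (M : nat) (f : 'I_M.+1 -> 'rV[R]_n -> 'rV[R]_n)
    (V : 'rV[R]_n -> R) (x : 'rV[R]_n) :
  admissible_law f V -> ~ switching_surface f V x ->
  min_region f V (switching_law f V x) x.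
Proof.
move=> adm nsx; have [i _ cli] : (\bigcup_i closure (min_region f V i)) x by rewrite adm.
have Di : min_region f V i x.
  apply: interior_subset; apply: contrapT => nI; apply: nsx.
  by exists i.
rewrite /switching_law; case: pickP => [j|/(_ i)]; first by rewrite inE.
by rewrite mem_set.
Qed.

Lemma filippov_decr (M : nat) (f : 'I_M.+1 -> 'rV[R]_n -> 'rV[R]_n)
    (V W : 'rV[R]_n -> R) (x v : 'rV[R]_n) :
  (forall i, continuous (f i)) -> continuous (gradient V) -> continuous W ->
  (forall y, (\big[Order.min/+oo]_(i < M.+1) (dotv (gradient V y) (f i y))%:E
     <= (- W y)%:E)%E) ->
  admissible_law f V -> lebesgue_null (switching_surface f V) ->
  filippov (closed_loop f V) x v -> dotv (gradient V x) v <= - W x.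
Proof.
move=> cf cV cW Vdecr adm null Fv; apply/ler_addgt0Pr => e e0.
(* If [i] is the mode at [y], the decrease condition at [y] makes [h i y] an upper bound of
   [dotv (gradient V x) (f i y)]. Moreover [h i x = - W x], and finitely many modes share one
   neighbourhood of [x]. *)
pose h i y := dotv (gradient V x) (f i y) - dotv (gradient V y) (f i y) - W y.
have ch i : continuous (h i).
  move=> y.
  apply: (@continuousB _ _ _ (fun z => dotv (gradient V x) (f i z) -
    dotv (gradient V z) (f i z)) W); last exact: cW.
  apply: (@continuousB _ _ _ (fun z => dotv (gradient V x) (f i z))
    (fun z => dotv (gradient V z) (f i z))).
    by apply: (continuous_dotv _ (fun=> gradient V x) (f i)) => z; [exact: cst_continuous|exact: cf].
  exact: (continuous_dotv _ (gradient V) (f i) cV (cf i)).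
have near_h i : \forall y \near x, h i y < - W x + e.
  by move/cvgr_lt: (ch i x); apply; rewrite /h subrr sub0r ltrDl.
have : nbhs x [set y | forall i, h i y < - W x + e].
  exact: (@filter_forall _ _ _ (nbhs x) _ near_h).
move=> /nbhs_ballP[d /= d0 dP].
(* The removed null set is the switching surface; the half-space is one of the closed convex sets
   intersected in the hull. *)
apply: (Fv d d0 _ null [set u | dotv (gradient V x) u <= - W x + e]); split.
  by split; [exact: closed_half_space | exact: convex_half_space].
move=> _ [y [yd ny] <-] /=.
have Dy := switching_law_min_region _ f V y adm ny.
have := min_region_decr _ f V _ y _ (Vdecr y) Dy.
have : h (switching_law f V y) y < - W x + e.
  apply: dP; rewrite -ball_normE /= distrC.
  by apply: le_lt_trans (norm_le_enorm _) yd.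
rewrite /h /closed_loop; lra.
Qed.

Lemma solution_decay (M : nat) (f : 'I_M.+1 -> 'rV[R]_n -> 'rV[R]_n)
    (V W : 'rV[R]_n -> R) (x : R -> 'rV[R]_n) (c s t : R) :
  (forall i, continuous (f i)) -> (forall y, differentiable V y) ->
  continuous (gradient V) -> continuous W ->
  (forall y, (\big[Order.min/+oo]_(i < M.+1) (dotv (gradient V y) (f i y))%:E
     <= (- W y)%:E)%E) ->
  admissible_law f V -> lebesgue_null (switching_surface f V) ->
  filippov_solution (closed_loop f V) x ->
  0 <= s -> s <= t -> (forall r, s <= r <= t -> - W (x r) <= c) ->
  V (x t) - V (x s) <= c * (t - s).
Proof.
move=> cf dV cV cW Vdecr adm null [acx aex] s0 st Wc.
(* Absolute continuity is given on [[0, T]] for [T > 0] only, and [t] may be 0. *)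
have t1 : 0 < t + 1 by rewrite ltr_wpDl// (le_trans s0).
apply: (abs_continuous_growth s t c (V \o x) st).
  apply: (abs_continuous_real_sub _ 0 (t + 1)) => //; first by rewrite lerDl.
  by apply: abs_continuous_comp_C1 => //; [exact: ltW | exact: acx].
case: aex => N [mN N0 NP]; exists N; split=> // r nr.
apply: NP => /= H; apply: nr => /andP[sr rt].
have [dx Fx] := H (le_trans s0 sr).
have dVx := is_derive_along V x r (dV _) dx.
split; first by have [] := dVx.
rewrite derive1E derive_val; apply: le_trans (Wc r _); last by rewrite sr.
exact: (filippov_decr _ f V W).
Qed.

End Lyapunov.

(** * Stability and attractivity of the origin *)

Theorem corollary26 (R : realType) (n M : nat)
    (f : 'I_M.+1 -> 'rV[R]_n -> 'rV[R]_n) (V W : 'rV[R]_n -> R)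
    (n_gt0 : (0 < n)%N)
    (f_lip : forall i, [locally [lipschitz (f i) x | x in [set: 'rV[R]_n]]])
    (f0 : forall i, f i 0 = 0)
    (V_ge0 : forall x, 0 <= V x)
    (V_diff : forall x : 'rV[R]_n, differentiable V x)
    (V_grad : continuous (gradient V))
    (W_ge0 : forall x, 0 <= W x)
    (W_cont : continuous W)
    (VW_gt0 : forall x : 'rV[R]_n, x != 0 -> 0 < V x /\ 0 < W x)
    (V0 : V 0 = 0)
    (V_bnd : forall beta : R, bounded_set [set x | V x <= beta])
    (V_decr : forall x,
       (\big[Order.min/+oo]_(i < M.+1) (dotv (gradient V x) (f i x))%:E
          <= (- W x)%:E)%E)
    (nu_adm : admissible_law f V)
    (surf_null : lebesgue_null (switching_surface f V)) :
  gas_including_sliding f V.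
Proof.
have cf i := locally_lipschitz_continuous (f i) (f_lip i).
have cV := continuous_C1 V V_diff.
have decay (x : R -> 'rV[R]_n) c s t := solution_decay M f V W x c s t
  cf V_diff V_grad W_cont V_decr nu_adm surf_null.
have mono (x : R -> 'rV[R]_n) (s t : R) : filippov_solution (closed_loop f V) x ->
    0 <= s -> s <= t -> V (x t) <= V (x s).
  move=> xsol s0 st; rewrite -subr_le0 -(mul0r (t - s)).
  by apply: decay => // r _; rewrite oppr_le0.
have V_pos (x : 'rV[R]_n) : x != 0 -> 0 < V x by move=> /VW_gt0[].
split=> [e e0|r r0 x [xsol _ _]].
  have [m m0 Vm] := sublevel_enorm_lt V e cV V_bnd V_pos e0.
  have /nbhs_ballP[d /= d0 dP] : nbhs (0 : 'rV[R]_n) [set z | V z < m].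
    by move/cvgr_lt: (cV 0); apply; rewrite V0.
  (* The initial bound is non-strict while the ball of radius [d] is open. *)
  exists (d / 2); first by rewrite divr_gt0.
  move=> x [xsol x0d _] t t0; apply: Vm; apply: le_lt_trans (mono x 0 t xsol _ t0) _ => //.
  apply: dP; rewrite -ball_normE /= sub0r normrN.
  apply: le_lt_trans (norm_le_enorm _) _; apply: le_lt_trans x0d _.
  by rewrite ltr_pdivrMr// mulr_natr ltrDl.
(* Otherwise the trajectory stays in the compact shell between the levels [m] and [V (x 0)], which
   excludes 0, so [W] has a positive minimum [W c] there. *)
have reach m : 0 < m -> exists2 T, 0 <= T & V (x T) < m.
  move=> m0; apply: contrapT => nT.
  have mV t : 0 <= t -> m <= V (x t).
    by move=> t0; rewrite leNgt; apply/negP => Vt; apply: nT; exists t.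
  have [|||c] := @EVT_min_rV R n W [set z | V z <= V (x 0) /\ m <= V z].
  - by exists (x 0); split=> //; exact: mV.
  - exact: sublevel_superlevel_compact.
  - exact: continuous_subspaceT.
  rewrite inE => -[_ mc] cmin.
  have [|_ Wc] := VW_gt0 c.
    by apply: contraTneq mc => ->; rewrite V0 -ltNge.
  (* At rate [W c] the value [V (x 0)] is used up by time [V (x 0) / W c]; the extra 1 forces
     [V (x T) < 0]. *)
  pose T := V (x 0) / W c + 1.
  have T0 : 0 <= T by rewrite addr_ge0// divr_ge0// ltW.
  have : V (x T) - V (x 0) <= - W c * (T - 0).
    apply: decay => // t /andP[t0 _]; rewrite lerN2; apply: cmin.
    by rewrite inE; split; [exact: mono | exact: mV].
  rewrite subr0 mulNr mulrDr mulr1 mulrC divfK ?gt_eqF//.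
  by have := V_ge0 (x T); lra.
apply/cvgrPdist_lt => e e0.
have [m m0 Vm] := sublevel_enorm_lt V e cV V_bnd V_pos e0.
have [T T0 VT] := reach m m0.
exists T; split=> [|t Tt]; first exact: num_real.
rewrite /= sub0r normrN; apply: le_lt_trans (norm_le_enorm _) _; apply: Vm.
by apply: le_lt_trans VT; apply: mono => //; exact: ltW.
Qed.
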